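(* (1) Let $F$ be a fixed graph with at least one edge and let $G$ be a fixed bipartite graph. Then $\mathrm{ex}_F(n,G)=O(\mathrm{ex}(n,G))$ as $n\to\infty$. Specifically, for every integer $\ell\ge 2$, $\mathrm{ex}_F(n,C_{2\ell})\le O(n^{1+1/\ell})$. (2) Let $k,\ell\ge 1$ be integers with $\ell>k$. Then $$\mathrm{ex}_{C_{2k+1}}(n,C_{2\ell+1})\le 8(k+1)^2\,\ell\, n^{1+1/\lceil \ell/k\rceil}.$$
   Context: All graphs are finite and simple. $C_m$ denotes the cycle of length $m$. $\mathrm{ex}(n,G)$ is the classical Turán number: the maximum number of edges in an $n$-vertex graph containing no copy of $G$ as a (not necessarily induced) subgraph. For graphs $F$ and $G$, the $F$-multicolor Turán number $\mathrm{ex}_F(n,G)$ is the maximum number of pairwise edge-disjoint copies of $F$ on a common vertex set of $n$ vertices such that the union of these copies contains no copy of $G$ whose edges all come from pairwise distinct copies of $F$ in the family (that is, giving each chosen copy of $F$ its own color, there is no rainbow copy of $G$). Constants implied in $O(\cdot)$ may depend on $F$ and $G$ (in particular on $\ell$). *)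

(* Defs.v *)
From mathcomp Require Import all_boot.

Set Implicit Arguments.
Unset Strict Implicit.
Unset Printing Implicit Defensive.

Definition edge_sets (T : finType) (E : {set {set T}}) : bool :=
  [forall e in E, #|e| == 2].

Record sgraph := SGraph {
  vertex :> finType;
  edges : {set {set vertex}};
  edgesP : edge_sets edges }.

Definition bipartite (G : sgraph) : Prop :=
  exists A : {set G}, forall e, e \in edges G -> #|e :&: A| = 1 /\ #|e :\: A| = 1.

(* The condition #|e| == 2 only matters for m <= 1, where {i, i + 1 mod m} is a
   singleton; for m >= 3 this is the cycle of length m. *)
Definition cycle_edges (m : nat) : {set {set 'I_m}} :=
  [set e : {set 'I_m} | (#|e| == 2) && [exists i : 'I_m, e == [set i; ordS i]]].

Lemma cycle_edgesP (m : nat) : edge_sets (cycle_edges m).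
Proof. by apply/forall_inP => e; rewrite inE => /andP[]. Qed.

Definition cycle_graph (m : nat) : sgraph := SGraph (cycle_edgesP m).

Definition contains_copy (n : nat) (H : {set {set 'I_n}}) (G : sgraph) : bool :=
  [exists f : {ffun G -> 'I_n},
     injectiveb f && [forall e in edges G, f @: e \in H]].

(* A subgraph of the complete graph on 'I_n: its vertex set and its edge set. *)
Definition subgraph (n : nat) : Type := {set 'I_n} * {set {set 'I_n}}.

Definition is_copy (n : nat) (F : sgraph) (C : subgraph n) : bool :=
  [exists f : {ffun F -> 'I_n},
     [&& injectiveb f, C.1 == f @: setT &
         C.2 == [set f @: (e : {set F}) | e in edges F]]].

Definition edge_disjoint_copies (n : nat) (F : sgraph) (S : {set subgraph n}) : bool :=
  [forall C in S, is_copy F C] &&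
  [forall C in S, forall D in S, (C != D) ==> [disjoint C.2 & D.2]].

(* [col] names, for each edge of G, the member of S that supplies its image. *)
Definition rainbow_copy (n : nat) (S : {set subgraph n}) (G : sgraph) : bool :=
  [exists f : {ffun G -> 'I_n}, exists col : {ffun {set G} -> subgraph n},
     [&& injectiveb f,
         dinjectiveb col (mem (edges G)) &
         [forall e in edges G, (col e \in S) && (f @: e \in (col e).2)]]].

(* In both definitions below the maximum over an empty range is 0; this happens
   only when G has no edges and at most n vertices. *)
Definition turan (n : nat) (G : sgraph) : nat :=
  \max_(H : {set {set 'I_n}} | edge_sets H && ~~ contains_copy H G) #|H|.

Definition multicolor_turan (n : nat) (F G : sgraph) : nat :=
  \max_(S : {set subgraph n} | edge_disjoint_copies F S && ~~ rainbow_copy S G) #|S|.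

(* Main.v *)
(* A family of edge-disjoint copies of F, restricted to one edge per copy, is a
   graph in which every copy of G is rainbow; hence ex_F(n, G) <= ex(n, G).

   For cycles, give each copy its own colour, pass to a subfamily in which every
   touched vertex lies in at least D copies (where D n bounds the size of the
   family), and grow from a root a breadth-first tree whose edges have pairwise
   distinct colours, adding as many vertices as possible at each stage.  A colour
   not used by the first i + 1 levels then changes the level by at most one
   at vertices of level <= i, so only as many colours as tree vertices misbehave.
   Within a level (or between two consecutive ones) the unused colours give
   at most linearly many edges in the number of vertices: otherwise they contain
   a subgraph of large minimum degree, hence a path of the length needed to close
   a rainbow cycle with the two tree paths from its ends to their last common
   ancestor.  For single edges this makes the balls grow by a factor D / O(l) at
   each level.  For odd cycles C_{2k+1}, a copy with an unused colour that
   touches the i-th ball lies in the (i + k)-th one and, by parity, has an edge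
   inside some level, so the balls grow by a factor D / O(k l) every k levels,
   that is ceil(l / k) times within l levels. *)

Require Import Defs.
From mathcomp Require Import all_boot.
From mathcomp Require Import zify.

Set Implicit Arguments.
Unset Strict Implicit.
Unset Printing Implicit Defensive.

(** * Set families in which every touched point has large degree *)

(** As long as possible, delete a point lying in at most [d] members together with those members.
    Each deletion lowers [d * #|U|] by [d] and [#|S|] by at most [d], so the strict inequality
    survives and the remaining family is nonempty. *)
Lemma dense_subfamily (V K : finType) (vs : K -> {set V}) (d : nat)
    (S : {set K}) (U : {set V}) :
  (forall c, c \in S -> vs c \subset U) -> d * #|U| < #|S| ->
  exists S' : {set K}, [/\ S' \subset S, S' != set0 &
    forall c v, c \in S' -> v \in vs c -> d < #|[set c' in S' | v \in vs c']|].
Proof.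
have [n leUn] := ubnP #|U|; elim: n => // n IHn in U S leUn * => sSU ltdS.
have [/existsP[v /andP[vU lev]]|/existsPn noV] :=
  boolP [exists v in U, #|[set c in S | v \in vs c]| <= d].
  have [|c||S' [sS' S'0 degS']] := IHn (U :\ v) [set c in S | v \notin vs c].
  - by have := cardsD1 v U; rewrite vU; lia.
  - rewrite inE => /andP[cS vc]; apply/subsetP => w wc; rewrite !inE.
    by rewrite (subsetP (sSU c cS)) // andbT; apply: contraNneq vc => <-.
  - have := cardsD1 v U; rewrite vU => cU.
    have := cardsID [set c | v \in vs c] S.
    have -> : S :&: [set c | v \in vs c] = [set c in S | v \in vs c].
      by apply/setP => c; rewrite !inE.
    have -> : S :\: [set c | v \in vs c] = [set c in S | v \notin vs c].
      by apply/setP => c; rewrite !inE andbC.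
    by nia.
  exists S'; split=> //; apply: subset_trans sS' _.
  by apply/subsetP => c; rewrite inE => /andP[].
exists S; split=> [//||c v cS vc].
  by apply: contraTneq ltdS => ->; rewrite cards0.
have := noV v; rewrite (subsetP (sSU c cS)) //=.
by rewrite -ltnNge.
Qed.

(** * Greedy paths in graphs of large minimum degree *)

Section GreedyPaths.
Variables (V : finType) (e : rel V) (p : nat).
Hypothesis e_sym : symmetric e.
Hypothesis e_irr : irreflexive e.
Hypothesis e_deg : forall u v, e u v -> p.+1 < #|[set w | e u w]|.

(** [F] lists forbidden vertices; each stage adds the vertex just left, and the degree always
    exceeds the size of [u :: F]. The edge [e u v] certifies the degree of [u]. *)
Lemma greedy_path u v (F : seq V) m : e u v -> size F + m <= p.+1 ->
  exists s, [/\ path e u s, uniq (u :: s), size s = m & ~~ has (mem F) s].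
Proof.
elim: m u v F => [|m IHm] u v F euv szF; first by exists [::].
have [w ew wF] : exists2 w, e u w & w \notin u :: F.
  apply/exists_inP; apply: contraT => /exists_inPn noW.
  have sub : [set w | e u w] \subset u :: F.
    by apply/subsetP => w; rewrite inE => /noW; rewrite negbK.
  have := leq_trans (e_deg euv) (leq_trans (subset_leq_card sub) (card_size _)).
  by rewrite /=; lia.
have [||s [pws uws szs Fs]] := IHm w u (u :: F).
- by rewrite e_sym.
- by rewrite /=; lia.
exists (w :: s); split=> //=; rewrite ?ew ?szs //.
  move: wF; rewrite !inE !negb_or eq_sym => /andP[-> wF].
  rewrite -[w \notin s]/(w \notin s) -andbA andbC.
  have -> /= : u \notin s.
    by apply/negP => us; case/hasP: Fs; exists u => //; rewrite inE mem_head.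
  by move: uws => /= /andP[-> ->].
move: wF; rewrite !inE !negb_or => /andP[_ ->] /=.
by apply: contra Fs => /hasP[y ys yF]; apply/hasP; exists y => //; apply: mem_behead.
Qed.

(* Both [w] and [w'] extend a path of length [p - 1] starting at [u]. *)
Lemma common_neighbour (T : Type) (f : V -> T) (X : pred V) :
  0 < p ->
  (forall a s, X a -> path e a s -> uniq (a :: s) -> size s = p ->
     f (last a s) = f a) ->
  forall u w w', e u w -> e u w' -> X w -> X w' -> f w = f w'.
Proof.
move=> p0 mono u w w' ew ew' Xw Xw'.
have [|s [ps us szs Fs]] := @greedy_path u w [:: w; w'] p.-1 ew; first by rewrite /=; lia.
have aux z : z \in [:: w; w'] -> e u z -> X z -> f (last u s) = f z.
  move=> zF ez Xz; apply: (mono z (u :: s)) => //=; last by lia.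
    by rewrite e_sym ez.
  rewrite -[_ && uniq s]/(uniq (u :: s)) us inE negb_or andbT; apply/andP; split.
    by apply: contraTneq ez => ->; rewrite e_irr.
  by apply: contra Fs => zs; apply/hasP; exists z.
by rewrite -(aux w) ?inE ?eqxx ?orbT // -(aux w') ?inE ?eqxx ?orbT.
Qed.

End GreedyPaths.

(** * Rainbow breadth-first trees *)

Section RainbowBFS.
Variables (V K : finType).
Implicit Types (E : K -> {set {set V}}).

(* A vertex of a walk is paired with the colour of the edge leading to it. *)
Definition rainbow_step E : rel (K * V) := [rel x y | [set x.2; y.2] \in E y.1].

Definition rainbow_cycle E m : Prop :=
  exists s : seq (K * V), [/\ size s = m, cycle (rainbow_step E) s,
    uniq (unzip1 s) & uniq (unzip2 s)].

Definition used_colors (dep : V -> nat) (tc : V -> K) (m : nat) : {set K} :=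
  [set tc w | w in [set w | 0 < dep w <= m]].

(* The tree consists of the vertices with [dep v <= l]; [tc v] is the colour of
   the edge from [v] to [par v].  The last clause is the maximality of each stage. *)
Definition rainbow_bfs E (x : V) (l : nat)
    (dep : V -> nat) (par : V -> V) (tc : V -> K) : Prop :=
  [/\ forall v, (dep v == 0) = (v == x),
      forall v, 0 < dep v <= l ->
        dep (par v) = (dep v).-1 /\ [set v; par v] \in E (tc v),
      {in [pred v | 0 < dep v <= l] &, injective tc} &
      forall u v c, dep u < l -> [set u; v] \in E c ->
        c \notin used_colors dep tc (dep u).+1 -> dep v <= (dep u).+1].

(** Induction on [l], strengthened so that all vertices not yet reached sit at depth exactly [l.+1].
    The next level is a largest set of them that attaches to level [l] by distinct fresh colours. *)
Lemma rainbow_bfs_exists E x l : K -> exists dep par tc, rainbow_bfs E x l dep par tc.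
Proof.
move=> c0.
suff [dep [par [tc [_ H]]]] : exists dep par tc,
    (forall v, dep v <= l.+1) /\ rainbow_bfs E x l dep par tc.
  by exists dep, par, tc.
elim: l => [|l [dep [par [tc [depb [dep0 depE tcI dl]]]]]].
  exists (fun v => nat_of_bool (v != x)), id, (fun=> c0).
  split=> [v|]; first by case: eqP.
  split=> // v; [by case: (v == x)|by case: (v == x)|].
  by move=> w; rewrite !inE; case: (v == x).
(* A candidate for level [l.+1]: a set of unreached vertices, and for each a parent on level [l]
   with a fresh colour, no colour repeated. *)
pose ok (Mf : {set V} * {ffun V -> V * K}) :=
  [forall v in Mf.1, [&& dep v == l.+1, dep (Mf.2 v).1 == l,
     [set v; (Mf.2 v).1] \in E (Mf.2 v).2 & (Mf.2 v).2 \notin used_colors dep tc l]] &&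
  [forall v in Mf.1, forall w in Mf.1, ((Mf.2 v).2 == (Mf.2 w).2) ==> (v == w)].
have ok0 : ok (set0, [ffun=> (x, c0)]).
  by apply/andP; split; apply/forall_inP => v; rewrite inE.
case: (@arg_maxnP _ (set0, [ffun=> (x, c0)]) ok (fun Mf => #|Mf.1|) ok0).
move=> [M f] /= /andP[/forall_inP okM /forall_inP inM] maxM.
(* Unreached vertices outside the largest candidate move on to depth [l.+2]. *)
pose dep' v := if (dep v == l.+1) && (v \notin M) then l.+2 else dep v.
pose par' v := if v \in M then (f v).1 else par v.
pose tc' v := if v \in M then (f v).2 else tc v.
have depM v : v \in M -> dep v = l.+1 by move=> /okM /and4P[/eqP].
have dep'E v : dep v <= l -> dep' v = dep v.
  by move=> lev; rewrite /dep'; case: eqP => // E1; lia.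
have dep'M v : v \in M -> dep' v = l.+1.
  by move=> vM; rewrite /dep' vM andbF depM.
have dep'l v : dep' v <= l -> dep v <= l.
  by rewrite /dep'; case: ifP => //; lia.
have nM v : dep v <= l -> v \notin M.
  by move=> lev; apply/negP => /depM; lia.
have dep'S v : dep' v <= l.+1 -> v \in M \/ dep v <= l.
  rewrite /dep'; case: (boolP (v \in M)) => [|_]; first by left.
  by rewrite andbT; case: eqP => // ne; have := depb v; right; lia.
have usedE m : m <= l -> used_colors dep' tc' m = used_colors dep tc m.
  move=> leml; apply/setP => c; apply/imsetP/imsetP => -[v]; rewrite inE => /andP[h1 h2] ->.
    have lv : dep v <= l by apply: dep'l; lia.
    exists v; first by rewrite inE -dep'E // h1 h2.
    by rewrite /tc' (negPf (nM _ lv)).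
  have lv : dep v <= l by lia.
  exists v; first by rewrite inE dep'E // h1 h2.
  by rewrite /tc' (negPf (nM _ lv)).
have usedM v : v \in M -> (f v).2 \notin used_colors dep tc l.
  by move=> /okM /and4P[].
have usedV v : 0 < dep' v -> dep v <= l -> tc v \in used_colors dep tc l.
  by move=> v0 lv; apply/imsetP; exists v => //; rewrite inE lv -dep'E ?v0.
exists dep', par', tc'; split; first by move=> v; rewrite /dep'; case: ifP; have := depb v; lia.
split.
- move=> v; rewrite -dep0 /dep'; case: ifP => // /andP[/eqP -> _] //.
- move=> v /andP[v0 vl]; have [vM|lv] := dep'S _ vl.
    have /and4P[_ /eqP dl' Ev _] := okM _ vM.
    by rewrite (dep'M v) // /par' /tc' vM dep'E dl'.
  rewrite (dep'E v) // in v0 *; rewrite /par' /tc' (negPf (nM _ lv)).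
  have [|dp Ev] := depE v; first by rewrite v0 lv.
  by rewrite dep'E dp //; lia.
- move=> v w; rewrite !inE => /andP[v0 vl] /andP[w0 wl].
  have [vM|lv] := dep'S _ vl; have [wM|lw] := dep'S _ wl; rewrite /tc'.
  + rewrite vM wM => /eqP eqc.
    by have := forall_inP (inM _ vM) _ wM; rewrite eqc => /eqP.
  + rewrite vM (negPf (nM _ lw)) => eqc; have := usedM _ vM.
    by rewrite eqc usedV.
  + rewrite wM (negPf (nM _ lv)) => eqc; have := usedM _ wM.
    by rewrite -eqc usedV.
  + rewrite (negPf (nM _ lv)) (negPf (nM _ lw)).
    rewrite dep'E // in v0; rewrite dep'E // in w0.
    by apply: tcI; rewrite inE ?v0 ?w0.
- move=> u v c; rewrite ltnS => lu Euv.
  have dul := dep'l _ lu; rewrite (dep'E u) // in lu * => nc.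
  have [ltul|] := ltnP (dep u) l.
    rewrite usedE // in nc; have := dl u v c ltul Euv nc => dv.
    by rewrite dep'E //; lia.
  move=> geul; have eul : dep u = l by lia.
  rewrite eul in nc *; rewrite leqNgt; apply/negP => ltv.
  have [vM dvl] : v \notin M /\ dep v = l.+1.
    move: ltv; rewrite /dep'; case: ifP => [/andP[/eqP -> ->] //|_].
    by have := depb v; lia.
  have nc' : c \notin used_colors dep tc l.
    rewrite -usedE //; apply: contra nc => /imsetP[w]; rewrite inE => /andP[h1 h2] ->.
    by apply/imsetP; exists w => //; rewrite inE h1; lia.
  have ncM w : w \in M -> (f w).2 != c.
    move=> wM; apply: contra nc => /eqP <-; apply/imsetP; exists w; last by rewrite /tc' wM.
    by rewrite inE dep'M // leqnn.
  (* An edge violating the last clause would let [v] join with parent [u] and colour [c], against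
     the maximality of [M]. *)
  pose f' := [ffun w => if w == v then (u, c) else f w].
  have /maxM : ok (v |: M, f').
    apply/andP; split; apply/forall_inP => w; rewrite !inE /= => /orP[/eqP->|wM].
    - by rewrite !ffunE eqxx /= dvl eul !eqxx nc' setUC Euv.
    - have wv : w == v = false by apply: contraTF wM => /eqP->.
      by rewrite !ffunE wv; apply: okM.
    - apply/forall_inP => z; rewrite !inE /= !ffunE eqxx => /orP[/eqP->|zM].
        by rewrite eqxx implybT.
      have zv : z == v = false by apply: contraTF zM => /eqP->.
      by rewrite zv /= eq_sym (negPf (ncM _ zM)).
    - have wv : w == v = false by apply: contraTF wM => /eqP->.
      apply/forall_inP => z; rewrite !inE /= !ffunE wv => /orP[/eqP->|zM].
        by rewrite eqxx /= (negPf (ncM _ wM)).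
      have zv : z == v = false by apply: contraTF zM => /eqP->.
      by rewrite zv; apply: (forall_inP (inM _ wM)).
  by rewrite /= cardsU1 vM; lia.
Qed.

End RainbowBFS.

(** * Closing rainbow cycles through the tree *)

Section LevelBound.
Variables (V K : finType) (E : K -> {set {set V}}).
Hypothesis E_card : forall c f, f \in E c -> #|f| = 2.
Hypothesis E_disj : forall c c' f, f \in E c -> f \in E c' -> c = c'.
Variables (x : V) (l : nat) (dep : V -> nat) (par : V -> V) (tc : V -> K).
Hypothesis bfs : rainbow_bfs E x l dep par tc.

Lemma dep_iter h v : dep v <= l -> h <= dep v -> dep (iter h par v) = dep v - h.
Proof.
have [_ depE _ _] := bfs.
move=> lv; elim: h => [|h IHh] hv; first by rewrite subn0.
rewrite iterS; have IH := IHh (ltnW hv).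
by have [|-> _] := depE (iter h par v); rewrite IH; lia.
Qed.

Lemma dep_traject h v z : dep v <= l -> h <= dep v -> z \in traject par v h ->
  0 < dep z <= dep v.
Proof. by move=> lv hv /trajectP[i ih ->]; rewrite dep_iter //; lia. Qed.

Lemma uniq_traject h v : dep v <= l -> h <= (dep v).+1 -> uniq (traject par v h).
Proof.
move=> lv hv; apply/(uniqP v) => i j; rewrite !inE !size_traject => ih jh.
rewrite !nth_traject // => /(congr1 dep).
by rewrite !dep_iter //; lia.
Qed.

(** Comparing depths gives [i = i'], and a coincidence at height [i] would persist up to height [h].
    The range of [i'] includes [h.+1] because one branch of the cycle closed below contains the
    common ancestor. *)
Lemma ancestors_neq h a b i i' : dep a = dep b -> dep a <= l -> h < dep a ->
  iter h par b != iter h par a -> i <= h -> i' <= h.+1 ->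
  iter i par a != iter i' par b.
Proof.
move=> ab al ha neq ih ih'; apply: contra neq => /eqP eqi.
have := congr1 dep eqi; rewrite !dep_iter -?ab //; try lia.
move=> eqd; have ii' : i = i' by lia.
by rewrite -ii' in eqi; rewrite -(subnK ih) !iterD eqi.
Qed.

Lemma used_traject h v z j : dep v <= j -> j <= l -> h <= dep v -> z \in traject par v h ->
  tc z \in used_colors dep tc j.
Proof.
move=> vj jl hv zt.
have [||z0 zv] := andP (dep_traject _ _ zt) => //; first exact: leq_trans jl.
by apply/imsetP; exists z => //; rewrite inE z0; lia.
Qed.

(** The tree edge at [z] enters [par z] on the way up and [z] on the way down, hence the pairs
    [(tc z, par z)] here and [(tc z, z)] in [descend_path]. *)
Lemma climb_path h (y : K * V) : dep y.2 <= l -> h <= dep y.2 ->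
  path (rainbow_step E) y [seq (tc z, par z) | z <- traject par y.2 h] /\
  (last y [seq (tc z, par z) | z <- traject par y.2 h]).2 = iter h par y.2.
Proof.
have [_ depE _ _] := bfs.
elim: h y => [|h IHh] [c v]; rewrite [(c, v).2]/= => lv hv //; rewrite trajectS iterSr /=.
have [|dp Ep] := depE v; first by rewrite lv; case: (dep v) hv.
have [||p1 p2] := IHh (tc v, par v); rewrite /= ?dp; [lia|lia|].
by split=> //; rewrite p1 andbT.
Qed.

Lemma descend_path h v (y : K * V) : dep v <= l -> h <= dep v -> y.2 = iter h par v ->
  path (rainbow_step E) y (rev [seq (tc z, z) | z <- traject par v h]) /\
  (last y (rev [seq (tc z, z) | z <- traject par v h])).2 = v.
Proof.
have [_ depE _ _] := bfs.
elim: h v => [|h IHh] v lv hv yE //; rewrite trajectS /=.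
have [|dp Ep] := depE v; first by rewrite lv; case: (dep v) hv.
have [|||p1 p2] := IHh (par v); rewrite -?iterSr ?dp //; [lia|lia|].
rewrite rev_cons rcons_path last_rcons; split=> //.
by rewrite p1 /rainbow_step /= p2 setUC.
Qed.

Variables (Q : {set K}) (ed : K -> {set V}).
Hypothesis edE : forall c, c \in Q -> ed c \in E c.

(** Keeping a single edge per colour makes every path without repeated vertices rainbow and lets
    degrees count colours. *)
Definition edge_rel : rel V := [rel u v | [exists c in Q, ed c == [set u; v]]].

Lemma edge_relP u v : reflect (exists2 c, c \in Q & ed c = [set u; v]) (edge_rel u v).
Proof. exact: exists_eq_inP. Qed.

Lemma edge_relC : symmetric edge_rel.
Proof. by move=> u v; apply: eq_existsb => c; rewrite [[set u; v]]setUC. Qed.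

Lemma edge_rel_irr : irreflexive edge_rel.
Proof.
move=> u; apply/negbTE/negP => /edge_relP[c cQ edc].
by have := E_card (edE cQ); rewrite edc setUid cards1.
Qed.

Lemma degree_edge_rel v :
  #|[set c in Q | v \in ed c]| <= #|[set w | edge_rel v w]|.
Proof.
rewrite -(@card_in_imset _ _ ed); last first.
  move=> c c'; rewrite !inE => /andP[cQ _] /andP[c'Q _] eqc.
  by apply: (E_disj (edE cQ)); rewrite eqc edE.
apply: leq_trans (leq_imset_card (fun w => [set v; w]) _).
apply/subset_leq_card/subsetP => f /imsetP[c]; rewrite inE => /andP[cQ vc] ->.
have /eqP/cards2P[u [w [uw edc]]] := E_card (edE cQ).
apply/imsetP; move: vc; rewrite edc !inE => /orP[]/eqP->.
  by exists w => //; rewrite inE; apply/edge_relP; exists c.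
exists u; last by rewrite setUC.
by rewrite inE; apply/edge_relP; exists c => //; rewrite edc setUC.
Qed.

(** The inclusion [ed c \subset a :: s] serves the induction: if the first colour came back later,
    its edge, which contains [a], would lie in the rest of the path. [d] is a dummy colour for the
    start. *)
Lemma path_colors a s d : path edge_rel a s -> uniq (a :: s) ->
  exists cs, [/\ size cs = size s, uniq cs, {subset cs <= Q},
    forall c, c \in cs -> ed c \subset a :: s &
    path (rainbow_step E) (d, a) (zip cs s)].
Proof.
elim: s a d => [|w s IHs] a d /=; first by exists [::].
move=> /andP[/edge_relP[c cQ edc] pws] /andP[aws uws].
have [cs [szc uc sQ sub pc]] := IHs w c pws uws.
exists (c :: cs); split=> /=.
- by rewrite szc.
- rewrite uc andbT; apply: contra aws => /sub; rewrite edc => /subsetP; apply.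
  by rewrite !inE eqxx.
- by move=> b; rewrite inE => /orP[/eqP->|/sQ].
- move=> b; rewrite inE => /orP[/eqP->|/sub/subset_trans -> //].
    by apply/subsetP => z; rewrite edc !inE => /orP[]->; rewrite ?orbT.
  by apply/subsetP => z zs; rewrite inE zs orbT.
- by rewrite pc andbT /rainbow_step /= -edc edE.
Qed.

Lemma close_cycle m j h a s :
  {in Q, forall c, c \notin used_colors dep tc j} ->
  ~ rainbow_cycle E m -> j <= l -> h < j -> size s + 2 * h.+1 = m ->
  path edge_rel a s -> uniq (a :: s) -> {in s, forall z, j <= dep z} ->
  dep a = j -> dep (last a s) = j ->
  iter h.+1 par (last a s) = iter h.+1 par a ->
  iter h par (last a s) = iter h par a.
Proof.
move=> Qun noC jl hj szm pas uas sj aj bj eqS; apply/eqP/negPn/negP => neq.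
apply: noC; set b := last a s in bj eqS neq.
have [cs [szc uc sQ _ pc]] := path_colors (tc a) pas uas.
(* From [a] along [s] to [b], up to the common ancestor, and down to [a]. The common ancestor is
   listed in [s2] only and [a] in [s3] only, so each cycle vertex occurs once. *)
pose s1 := zip cs s.
pose s2 := [seq (tc z, par z) | z <- traject par b h.+1].
pose s3 := rev [seq (tc z, z) | z <- traject par a h.+1].
have s1u : unzip1 s1 = cs by rewrite unzip1_zip // szc.
have s1v : unzip2 s1 = s by rewrite unzip2_zip // szc.
have lastE : (last (tc a, a) s1).2 = b.
  by rewrite -(last_map snd) -/(unzip2 _) s1v.
have [||] := @climb_path h.+1 (last (tc a, a) s1); rewrite ?lastE ?bj //.
rewrite -/s2 => pu lu.
have [|||] := @descend_path h.+1 a (last (last (tc a, a) s1) s2); rewrite ?lu ?aj //.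
rewrite -/s3 => pd _.
have desc v z : dep v = j -> z \in traject par v h.+1 -> 
    0 < dep z <= j /\ tc z \in used_colors dep tc j.
  move=> vj zt; split; last by apply: used_traject zt; rewrite ?vj.
  by rewrite -vj; apply: dep_traject zt; rewrite vj.
exists (s1 ++ s2 ++ s3); split.
- by rewrite -szm !size_cat size_rev !size_map !size_traject size_zip szc minnn mul2n addnn.
- have ps : path (rainbow_step E) (tc a, a) (s1 ++ s2 ++ s3).
    by rewrite !cat_path pc pu pd.
  have lst : last (tc a, a) (s1 ++ s2 ++ s3) = (tc a, a).
    by rewrite !last_cat /s3 trajectS /= rev_cons last_rcons.
  case: (s1 ++ s2 ++ s3) ps lst => // y t /=.
  by rewrite rcons_path => /andP[ps1 ps2] ->; rewrite ps2 ps1.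
- rewrite /unzip1 !map_cat -/(unzip1 s1) s1u map_rev -!map_comp.
  rewrite (eq_map (g := tc)) // [X in rev X](eq_map (g := tc)) // -map_rev -map_cat.
  set t := _ ++ rev _.
  have tP z : z \in t -> 0 < dep z <= j /\ tc z \in used_colors dep tc j.
    by rewrite mem_cat mem_rev => /orP[]; apply: desc.
  rewrite cat_uniq uc andTb; apply/andP; split.
    apply/hasPn => c /mapP[z /tP[_ zu] ->]; apply: contraL zu => /sQ; exact: Qun.
  rewrite map_inj_in_uniq.
    rewrite cat_uniq rev_uniq !uniq_traject ?aj ?bj //; try exact: ltnW.
    rewrite andbT andTb; apply/hasPn => z; rewrite mem_rev => /trajectP[i ih ->].
    apply/negP => /trajectP[i' ih' /eqP]; apply/negP.
    by apply: ancestors_neq neq _ _; rewrite ?aj ?bj //; exact: ltnW.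
  move=> z w /tP[/andP[z0 zj] _] /tP[/andP[w0 wj] _].
  have [_ _ tcI _] := bfs.
  by apply: tcI; rewrite inE ?z0 ?w0 /=; [exact: leq_trans zj jl|exact: leq_trans wj jl].
- rewrite /unzip2 !map_cat -/(unzip2 s1) s1v map_rev -!map_comp.
  rewrite (eq_map (g := par)) // [X in rev X](eq_map (g := id)) // map_id.
  have -> : map par (traject par b h.+1) = traject par (par b) h.+1.
    by elim: (h.+1) (b) => // i IHi v; rewrite !trajectS /= IHi.
  have parbj : dep (par b) = j.-1.
    by have [_ depE _ _] := bfs; have [|->] := depE b; rewrite bj ?jl // (leq_trans _ hj).
  have [uas1 us] : a \notin s /\ uniq s by apply/andP.
  rewrite cat_uniq us andTb; apply/andP; split.
    rewrite has_cat has_rev negb_or; apply/andP; split; apply/hasPn => z.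
      move=> /trajectP[i ih ->]; apply/negP => /sj.
      rewrite -iterSr dep_iter ?bj //; last exact: leq_trans hj.
      by rewrite leqNgt ltn_subrL (leq_trans _ hj).
    move=> /trajectP[[|i] ih ->] //; apply/negP => /sj.
    rewrite dep_iter ?aj //; last exact: leq_trans (ltnW ih) hj.
    by rewrite leqNgt ltn_subrL (leq_trans _ hj).
  rewrite cat_uniq rev_uniq !uniq_traject ?aj ?parbj //.
  - rewrite andbT andTb; apply/hasPn => z; rewrite mem_rev => /trajectP[i ih ->].
    apply/negP => /trajectP[i' ih']; rewrite -iterSr => /eqP; apply/negP.
    by apply: ancestors_neq neq _ _; rewrite ?aj ?bj.
  - exact: ltnW.
  - by rewrite (leq_trans (leq_pred _)).
  - by rewrite prednK // (leq_trans _ hj).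
Qed.
End LevelBound.

(** The path is consumed two edges at a time, each pair being read as two edges leaving its middle
    vertex. *)
Lemma even_path_invariant (V : finType) (T : Type) (e : rel V) (X : pred V) (f : V -> T) :
  symmetric e ->
  (forall u w w', e u w -> e u w' -> X w -> X w' /\ f w = f w') ->
  forall a s, X a -> path e a s -> ~~ odd (size s) ->
  X (last a s) /\ f (last a s) = f a.
Proof.
move=> e_sym step a s; have [n] := ubnP (size s).
elim: n a s => // n IHn a [|u [|w s]] //=; rewrite !ltnS negbK => szs Xa.
move=> /and3P[eau euw pws] odds.
have [Xw fw] := step u a w (etrans (e_sym _ _) eau) euw Xa.
by rewrite fw; apply: IHn => //; exact: ltnW.
Qed.

Section UnusedLevelBound.
Variables (V K : finType) (E : K -> {set {set V}}).
Hypothesis E_card : forall c f, f \in E c -> #|f| = 2.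
Hypothesis E_disj : forall c c' f, f \in E c -> f \in E c' -> c = c'.
Variables (x : V) (l : nat) (dep : V -> nat) (par : V -> V) (tc : V -> K).
Hypothesis bfs : rainbow_bfs E x l dep par tc.

Section Edges.
(* Cycles of length [2 l + o]; each edge joins level [j] to level [j + b]. *)
Variables (o b : bool) (j : nat) (Q : {set K}) (ed : K -> {set V}).
Hypothesis ob : o -> ~~ b.
Hypothesis jl : j + ~~ o <= l.
Hypothesis noC : ~ rainbow_cycle E (2 * l + o).
Hypothesis Qun : {in Q, forall c, c \notin used_colors dep tc j}.
Hypothesis edE : forall c, c \in Q -> ed c \in E c.
Hypothesis edj : forall c, c \in Q ->
  exists u v, [/\ ed c = [set u; v], dep u = j & dep v = j + b].
Let e := edge_rel Q ed.
Hypothesis e_deg : forall u v, e u v -> 2 * l < #|[set w | e u w]|.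

Let e_sym : symmetric e := edge_relC Q ed.

Let e_dep u v : e u v -> dep u = j /\ dep v = j + b \/ dep v = j /\ dep u = j + b.
Proof.
move=> /edge_relP[c /edj[u' [v' [-> du dv]]] eqs].
have := set21 u v; have := set22 u v; have := set21 u' v'; have := set22 u' v'.
rewrite eqs -{3 4}eqs !inE.
by move=> /orP[]/eqP ? /orP[]/eqP ? /orP[]/eqP ? /orP[]/eqP ?; subst; auto.
Qed.

(** Given an edge, take the least height at which [r]-related vertices have equal ancestors; the
    degree bound excludes 0. If it is [h.+1], a path of [p] edges starting on level [j] has ends
    with equal ancestors at height [h.+1], and by [close_cycle] already at height [h]. Greedy paths
    transfer this to all [r]-related vertices, against minimality. *)
Lemma edge_rel_empty u v : ~~ e u v.
Proof.
apply/negP; wlog: u v / dep u = j => [wl euv|du euv].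
  by have [[du _]|[dv _]] := e_dep euv; [apply: (wl u v)|apply: (wl v u); rewrite // e_sym].
have e_irr : irreflexive e := edge_rel_irr E_card edE.
have e_two w z z' : e w z -> e w z' -> dep z = j -> dep z' = j.
  by move=> /e_dep[[]|[]] + + /e_dep[[]|[]]; lia.
have e_odd w z : o -> e w z -> dep z = j.
  by move=> /ob/negPf b0 /e_dep; rewrite b0; lia.
(* For odd cycles related vertices are adjacent. For even ones adjacent vertices may lie on
   different levels, so a common neighbour is used instead. *)
pose r := [rel w z | if o then e w z else
  [&& dep w == j, dep z == j & [exists y, e y w && e y z]]].
pose P h := [forall w, forall z, r w z ==> (iter h par w == iter h par z)].
have root w : dep w = j -> iter j par w = x.
  move=> dw; have [dep0 _ _ _] := bfs; apply/eqP; rewrite -dep0.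
  by rewrite (dep_iter bfs) ?dw ?subnn //; lia.
(* The least [h] with [P h] is the height above level [j] of the last common
   ancestor of suitable ends of a path. *)
have PX : exists h, P h.
  exists j; apply/'forall_'forall_implyP => w z; rewrite /r /=.
  case: ifP => [o1 ewz|_ /and3P[/eqP dw /eqP dz _]]; last by rewrite !root.
  by rewrite !root // ?(e_odd w z) // (e_odd z w) // e_sym.
have [h Ph minh] := ex_minnP PX.
have hj : h <= j.
  apply: minh; apply/'forall_'forall_implyP => w z; rewrite /r /=.
  case: ifP => [o1 ewz|_ /and3P[/eqP dw /eqP dz _]]; last by rewrite !root.
  by rewrite !root // ?(e_odd w z) // (e_odd z w) // e_sym.
have rP g w z : P g -> r w z -> iter g par w = iter g par z.
  by move=> /'forall_'forall_implyP Pg /Pg /eqP.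
(* At height 0 related vertices coincide: the edge is a loop if [o] holds, and otherwise [u] is the
   only neighbour of [v]. *)
case: h => [|h] in Ph minh hj *.
  have := e_deg (etrans (e_sym v u) euv); rewrite ltnNge => /negP; apply.
  case: (boolP o) => o1.
    by have := rP 0 u v Ph; rewrite /r /= o1 => /(_ euv) /= eq_uv; rewrite eq_uv e_irr in euv.
  suff /subset_leq_card : [set w | e v w] \subset [set u].
    rewrite cards1 => /leq_trans; apply; move: jl; rewrite o1; lia.
  apply/subsetP => w; rewrite !inE => evw; rewrite eq_sym; apply/eqP.
  apply: (rP 0 u w Ph); rewrite /r /= (negPf o1) du eqxx /=.
  rewrite (e_two v u w) ?eqxx //=; last by rewrite e_sym.
  by apply/existsP; exists v; rewrite e_sym euv.
have nPh : ~~ P h by apply: contraT; rewrite negbK => /minh; rewrite ltnn.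
have hl : h < l := leq_trans hj (leq_trans (leq_addr _ _) jl).
(* The edges left for the path after two branches of height [h.+1]; [jl] makes this number
   positive. *)
pose p := 2 * l + o - 2 * h.+1.
have p0 : 0 < p by rewrite /p; move: jl; case: (o) => /=; lia.
have pl : p < 2 * l by rewrite /p; case: (o) => /=; lia.
have deg_p w z : e w z -> p.+1 < #|[set y | e w y]|.
  by move/e_deg; apply: leq_trans; rewrite ltnS.
have two g : P g -> forall w z z', e w z -> e w z' -> dep z == j ->
    dep z' == j /\ iter g par z = iter g par z'.
  move=> Pg w z z' ez ez' /eqP dz; have dz' := e_two _ _ _ ez ez' dz; rewrite dz'; split=> //.
  case: (boolP o) => o1.
    have rw y : e w y -> r w y by rewrite /r /= o1.
    by rewrite -(rP g w z Pg (rw _ ez)) (rP g w z' Pg (rw _ ez')).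
  apply: (rP g _ _ Pg); rewrite /r /= (negPf o1) dz dz' eqxx /=.
  by apply/existsP; exists w; rewrite ez.
have ends a s : dep a == j -> path e a s -> size s = p ->
    dep (last a s) = j /\ iter h.+1 par (last a s) = iter h.+1 par a.
  move=> da pas szs; case: (boolP o) => o1; last first.
    have [|/eqP dl it] := even_path_invariant e_sym (two _ Ph) da pas; last by [].
    by rewrite szs /p (negPf o1) addn0 -mulnBr mul2n odd_double.
  elim: s a da pas {szs} => [|w s IHs] a /eqP da //= /andP[eaw pws].
  have [|-> it] := IHs w _ pws; first by rewrite (e_odd a w).
  split=> //; rewrite -iterS it; apply/esym/(rP h.+1 a w Ph).
  by rewrite /r /= o1.
have mono a s : dep a == j -> path e a s -> uniq (a :: s) -> size s = p ->
    iter h par (last a s) = iter h par a.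
  move=> da pas uas szs; have [dl it] := ends a s da pas szs.
  apply: (close_cycle bfs edE Qun noC) => //.
  - exact: leq_trans (leq_addr _ _) jl.
  - by rewrite szs /p; move: jl; case: (o) => /=; lia.
  - move=> z zs; have [w ewz] : exists w, e w z.
      elim: s a {da uas szs dl it} pas zs => // y s IHs a /= /andP[eay pys].
      by rewrite inE => /orP[/eqP->|]; [exists a|exact: IHs pys].
    by case: (e_dep ewz) => [[_ ->]|[-> _]]; rewrite ?leq_addr.
  - exact/eqP.
have twoh w z z' : e w z -> e w z' -> dep z == j ->
    dep z' == j /\ iter h par z = iter h par z'.
  move=> ez ez' dz; have /eqP dz' : dep z' = j by apply: e_two ez ez' (eqP dz).
  split=> //.
  by apply: (common_neighbour e_sym e_irr deg_p p0 mono ez ez').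
case/negP: nPh; apply/'forall_'forall_implyP => w z; rewrite /r /=.
case: ifP => [o1 ewz|_ /and3P[dw dz /existsP[y /andP[eyw eyz]]]]; last first.
  by have [_ ->] := twoh _ _ _ eyw eyz dw.
have dw : dep w == j by rewrite (e_odd z w) // e_sym.
have dz : dep z == j by rewrite (e_odd w z).
have ezw : e z w by rewrite e_sym.
(* Odd case: [mono] compares the ends of the path [w, z, s] of [p] edges, and [twoh] compares those
   of [z, s], whose number of edges [p.-1] is even. *)
have [|s [pzs uzs szs ws]] := greedy_path e_sym deg_p (m := p.-1) (F := [:: w]) ezw.
  by rewrite /= add1n prednK // leqnSn.
have := mono w (z :: s); rewrite /= szs prednK // ewz pzs => <- //.
  have [|_ ->] := even_path_invariant e_sym twoh dz pzs; last by [].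
  by rewrite szs /p o1 -addnBAC ?leq_mul2l ?hl // addn1 -mulnBr mul2n odd_double.
rewrite -[_ && uniq s]/(uniq (z :: s)) uzs andbT inE negb_or.
rewrite (contraTneq _ ewz) => [/=|->]; last by rewrite e_irr.
by apply: contra ws => ws; apply/hasP; exists w; last exact: mem_head.
Qed.
End Edges.

(** Choose one admissible edge per colour. With more colours, [dense_subfamily] would leave a
    nonempty graph whose touched vertices all have degree above [2 * l], contradicting
    [edge_rel_empty]. *)
Lemma unused_level_bound (o b : bool) (j : nat) (Q : {set K}) :
  (o -> ~~ b) -> j + ~~ o <= l -> ~ rainbow_cycle E (2 * l + o) ->
  (forall c, c \in Q -> c \notin used_colors dep tc j /\
     exists u v, [/\ [set u; v] \in E c, dep u = j & dep v = j + b]) ->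
  #|Q| <= 2 * l * #|[set v | (dep v == j) || (dep v == j + b)]|.
Proof.
move=> ob jl noC QE; rewrite leqNgt; apply/negP => ltQ.
pose good c (f : {set V}) := (f \in E c) &&
  [exists u, exists v, [&& f == [set u; v], dep u == j & dep v == j + b]].
pose ed c := odflt set0 [pick f | good c f].
have edP c : c \in Q -> good c (ed c).
  move=> /QE[_ [u [v [uvc du dv]]]]; rewrite /ed; case: pickP => // /(_ [set u; v]).
  rewrite /good uvc /= => /negbT/negP[]; apply/existsP; exists u; apply/existsP; exists v.
  by rewrite du dv !eqxx.
have edj c : c \in Q -> exists u v, [/\ ed c = [set u; v], dep u = j & dep v = j + b].
  by move=> /edP; rewrite /good => /andP[_ /existsP[u /existsP[v /and3P[/eqP ? /eqP ? /eqP ?]]]];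
  exists u, v.
have [|Q' [sQ Q'0 degQ]] := dense_subfamily (vs := ed) _ ltQ.
  move=> c /edj[u [v [-> du dv]]]; apply/subsetP => w; rewrite !inE.
  by move=> /orP[]/eqP->; rewrite ?du ?dv eqxx ?orbT.
have edE' c : c \in Q' -> ed c \in E c by move=> /(subsetP sQ) /edP /andP[].
have [c cQ'] := set0Pn _ Q'0; have [u [v [edc _ _]]] := edj c (subsetP sQ _ cQ').
apply: (negP (@edge_rel_empty o b j Q' ed ob jl noC _ edE' _ _ u v)).
- by move=> d /(subsetP sQ) /QE[].
- by move=> d /(subsetP sQ) /edj.
- move=> w z /edge_relP[d dQ' edd].
  apply: leq_trans (degree_edge_rel E_card E_disj edE' w); apply: degQ dQ' _.
  by rewrite edd set21.
- by apply/edge_relP; exists c.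
Qed.

End UnusedLevelBound.

(** * Expansion of the balls of the tree *)

Lemma card_bigcup_leq (T : finType) m (A : nat -> {set T}) :
  #|\bigcup_(i < m) A i| <= \sum_(i < m) #|A i|.
Proof.
elim: m => [|m IHm]; first by rewrite !big_ord0 cards0.
rewrite !big_ord_recr /=; apply: leq_trans (leq_card_setU _ _) _.
by rewrite leq_add2r.
Qed.

Lemma dense_core (V K : finType) (E : K -> {set {set V}}) (S : {set K}) :
  (forall c, c \in S -> cover (E c) != set0) -> S != set0 ->
  exists S' : {set K}, exists D, [/\ S' \subset S, S' != set0, #|S| <= D * #|V| &
    forall c v, c \in S' -> v \in cover (E c) -> D <= #|[set c in S' | v \in cover (E c)]|].
Proof.
move=> Ene S0; have [c cS] := set0Pn _ S0; have [v _] := set0Pn _ (Ene c cS).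
have V0 : 0 < #|V| by apply/card_gt0P; exists v.
(* The largest [d] with [d * #|V| < #|S|], so that [D = d.+1] satisfies [#|S| <= D * #|V|]. *)
pose d := #|S|.-1 %/ #|V|.
have [||S' [sS S'0 deg]] := @dense_subfamily V K (fun c => cover (E c)) d S setT.
- by move=> *; apply: subsetT.
- rewrite cardsT; have := leq_divM #|S|.-1 #|V|; rewrite -/d => h.
  by apply: leq_ltn_trans h _; rewrite prednK // card_gt0.
exists S', d.+1; split=> //.
have := ltn_ceil #|S|.-1 V0; rewrite -/d; case: #|S| => //.
Qed.

(** Periodic indexing by all naturals lets the walk be followed both ways from any vertex without
    modular arithmetic. *)
Definition odd_closed_walk (V : finType) (k : nat) (C : {set {set V}}) : Prop :=
  exists w : nat -> V, [/\ forall i, [set w i; w i.+1] \in C,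
    forall i, w (i + (2 * k + 1)) = w i &
    forall v, v \in cover C -> exists2 i, i < 2 * k + 1 & v = w i].

Section Expansion.
Variables (V K : finType) (E : K -> {set {set V}}).
Hypothesis E_card : forall c f, f \in E c -> #|f| = 2.
Hypothesis E_disj : forall c c' f, f \in E c -> f \in E c' -> c = c'.
Variables (x : V) (l : nat) (dep : V -> nat) (par : V -> V) (tc : V -> K).
Hypothesis bfs : rainbow_bfs E x l dep par tc.

Let ball m := [set v | dep v <= m].
Let level j := [set v | dep v == j].
Let touching i := [set c | [exists v in cover (E c), dep v <= i]].

Lemma sum_levels m : \sum_(j < m.+1) #|level j| = #|ball m|.
Proof.
elim: m => [|m IHm].
  by rewrite big_ord1; apply: eq_card => v; rewrite !inE leqn0.
rewrite big_ord_recr /= IHm -cardsUI (_ : _ :&: _ = set0) ?cards0 ?addn0.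
  by apply: eq_card => v; rewrite !inE (leq_eqVlt _ m.+1) orbC.
by apply/setP => v; rewrite !inE; apply/negbTE; lia.
Qed.

Lemma card_used m : #|used_colors dep tc m| <= #|ball m|.
Proof.
apply: leq_trans (leq_imset_card _ _) _; apply/subset_leq_card/subsetP => v.
by rewrite !inE => /andP[].
Qed.

Lemma used_sub m m' : m <= m' -> used_colors dep tc m \subset used_colors dep tc m'.
Proof.
move=> le; apply/imsetS/subsetP => v; rewrite !inE => /andP[-> /leq_trans]; exact.
Qed.

Lemma unused_lipschitz m u v c : m <= l -> c \notin used_colors dep tc m ->
  [set u; v] \in E c -> dep u < m -> dep v <= (dep u).+1.
Proof.
have [_ _ _ lip] := bfs.
move=> ml cm Ec um; apply: lip Ec _; first exact: leq_trans ml.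
by apply: contra cm; apply/subsetP/used_sub.
Qed.

Lemma double_count i q D :
  (forall v, dep v <= i -> D <= #|[set c | v \in cover (E c)]|) ->
  (forall c, #|cover (E c)| <= q) -> D * #|ball i| <= q * #|touching i|.
Proof.
move=> deg leq.
apply: (@leq_trans (\sum_(v in ball i) \sum_(c | v \in cover (E c)) 1)).
  rewrite mulnC -sum_nat_const; apply: leq_sum => v; rewrite inE => /deg/leq_trans; apply.
  by rewrite sum1dep_card.
rewrite (exchange_big_dep (mem (touching i))) /=; last first.
  move=> v c; rewrite !inE => vi vc; apply/exists_inP; exists v => //.
rewrite mulnC -sum_nat_const; apply: leq_sum => c _.
rewrite sum1dep_card; apply: leq_trans (leq c); apply/subset_leq_card/subsetP => v.
by rewrite inE => /andP[].
Qed.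

Definition unused_at m j (b : bool) : {set K} := [set c | (c \notin used_colors dep tc m) &&
  [exists u, exists v, [&& [set u; v] \in E c, dep u == j & dep v == j + b]]].

Lemma card_unused_at (o b : bool) m j : (o -> ~~ b) -> j + ~~ o <= l -> j <= m ->
  ~ rainbow_cycle E (2 * l + o) ->
  #|unused_at m j b| <= 2 * l * (#|level j| + b * #|level j.+1|).
Proof.
move=> ob jl jm noC.
apply: leq_trans (unused_level_bound E_card E_disj bfs ob jl noC _) _.
  move=> c; rewrite inE => /andP[cm /existsP[u /existsP[v /and3P[Ec /eqP du /eqP dv]]]].
  split; last by exists u, v.
  by apply: contra cm; apply/subsetP/used_sub.
rewrite leq_mul2l; apply/orP; right; case: b {ob}.
  rewrite mul1n addn1 -cardsUI; apply: leq_trans (leq_addr _ _).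
  by apply/subset_leq_card/subsetP => v; rewrite !inE.
rewrite mul0n !addn0.
by apply/subset_leq_card/subsetP => v; rewrite !inE orbb.
Qed.

(** A touching colour is used up to level [i.+1], which holds for at most [#|ball i.+1|] colours, or
    has an edge within a level [j <= i] or from it to level [j.+1]. The latter cost
    [2 * l * (2 * #|level j| + #|level j.+1|)] for each [j], in total at most
    [6 * l * #|ball i.+1|]. *)
Lemma even_expansion i D : i < l -> ~ rainbow_cycle E (2 * l) ->
  (forall v, dep v <= i -> D <= #|[set c | v \in cover (E c)]|) ->
  (forall c, #|cover (E c)| <= 2) ->
  D * #|ball i| <= 2 * (6 * l + 1) * #|ball i.+1|.
Proof.
move=> il noC deg le2; apply: leq_trans (double_count deg le2) _.
rewrite -mulnA leq_mul2l /=.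
have sub : touching i \subset used_colors dep tc i.+1 :|:
    \bigcup_(j < i.+1) (unused_at i.+1 j false :|: unused_at i.+1 j true).
  apply/subsetP => c; rewrite inE => /exists_inP[v /bigcupP[f fE vf] vi].
  rewrite inE; case: (boolP (c \in _)) => //= cu.
  have [w fvw] : exists w, f = [set v; w].
    have /eqP/cards2P[u [w [uw fE']]] := E_card fE.
    move: vf; rewrite fE' !inE => /orP[]/eqP->; first by exists w.
    by exists u; rewrite setUC.
  rewrite fvw in fE.
  have dw := unused_lipschitz il cu fE vi.
  have [dw0|dw1] := ltnP (dep w) (dep v); last first.
    apply/bigcupP; exists (Ordinal (vi : dep v < i.+1)) => //; rewrite !inE cu /=.
    have [dvw|dvw] := eqVneq (dep w) (dep v); apply/orP; [left|right];
      apply/existsP; exists v; apply/existsP; exists w; rewrite fE eqxx /=; lia.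
  have dv : dep v <= (dep w).+1.
    by apply: (unused_lipschitz il cu); [rewrite setUC|lia].
  have wi : dep w < i.+1 by lia.
  apply/bigcupP; exists (Ordinal wi) => //; rewrite !inE cu /=; apply/orP; right.
  apply/existsP; exists w; apply/existsP; exists v; rewrite setUC fE eqxx /=; lia.
apply: leq_trans (subset_leq_card sub) _.
apply: leq_trans (leq_card_setU _ _) _.
apply: leq_trans (leq_add (card_used _) (card_bigcup_leq _
  (fun j => unused_at i.+1 j false :|: unused_at i.+1 j true))) _.
have le6 : \sum_(j < i.+1) #|unused_at i.+1 j false :|: unused_at i.+1 j true| <= 
    \sum_(j < i.+1) 2 * l * (2 * #|level j| + #|level j.+1|).
  apply: leq_sum => j _; apply: leq_trans (leq_card_setU _ _) _.
  have jl : j + ~~ false <= l by rewrite addn1; apply: leq_trans il.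
  have noC' : ~ rainbow_cycle E (2 * l + false) by rewrite addn0.
  have h0 := @card_unused_at false false i.+1 j (fun=> isT) jl (ltnW (ltn_ord j)) noC'.
  have h1 := @card_unused_at false true i.+1 j id jl (ltnW (ltn_ord j)) noC'.
  by nia.
have := sum_levels i.+1; rewrite big_ord_recl /= => s1.
have s1' : \sum_(j < i.+1) #|level j.+1| <= #|ball i.+1| by rewrite -s1 leq_addl.
have := sum_levels i => s0.
have s2 : #|ball i| <= #|ball i.+1|.
  by apply/subset_leq_card/subsetP => v; rewrite !inE => /leqW.
rewrite -big_distrr big_split -big_distrr /= s0 in le6.
rewrite [leqRHS]mulnDl mul1n addnC leq_add2r; apply: leq_trans le6 _.
rewrite -[leqRHS]mulnA (_ : 6 * _ = 2 * l * (3 * #|ball i.+1|)); last by lia.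
rewrite leq_mul2l; apply/orP; right; rewrite (_ : 3 = 2 + 1) // mulnDl mul1n.
by rewrite leq_add // leq_mul2l.
Qed.

Lemma odd_expansion k i D : i + k <= l -> ~ rainbow_cycle E (2 * l + 1) ->
  (forall v, dep v <= i -> D <= #|[set c | v \in cover (E c)]|) ->
  (forall c, cover (E c) != set0 -> odd_closed_walk k (E c)) ->
  D * #|ball i| <= (2 * k + 1) * (2 * l + 1) * #|ball (i + k)|.
Proof.
move=> ikl noC deg odd_c.
have leN c : #|cover (E c)| <= 2 * k + 1.
  have [->|/odd_c[w [_ _ w_on]]] := eqVneq (cover (E c)) set0; first by rewrite cards0.
  rewrite -[leqRHS]card_ord; apply: leq_trans (leq_imset_card (fun j : 'I__ => w j) _).
  apply/subset_leq_card/subsetP => v /w_on[j jN ->].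
  by apply/imsetP; exists (Ordinal jN).
apply: leq_trans (double_count deg leN) _.
rewrite -mulnA leq_mul2l; apply/orP; right.
set m := i + k in ikl *.
have sub : touching i \subset used_colors dep tc m :|: \bigcup_(j < m.+1) unused_at m j false.
  apply/subsetP => c; rewrite inE => /exists_inP[v vc vi].
  rewrite inE; case: (boolP (c \in _)) => //= cu.
  have [|w [wE wP w_on]] := odd_c c; first by apply/set0Pn; exists v.
  have [i0 _ vw] := w_on v vc; rewrite {v vc}vw in vi.
  have fwd t : t <= k -> dep (w (i0 + t)) <= i + t.
    elim: t => [|t IHt] tk; first by rewrite !addn0.
    have IH := IHt (ltnW tk); rewrite !addnS.
    apply: leq_trans (unused_lipschitz ikl cu (wE _) _) _; rewrite /m; lia.
  have bwd t : t <= k -> dep (w (i0 + (2 * k + 1 - t))) <= i + t.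
    elim: t => [|t IHt] tk; first by rewrite subn0 addn0 wP.
    have IH := IHt (ltnW tk).
    have Et : [set w (i0 + (2 * k + 1 - t)); w (i0 + (2 * k + 1 - t.+1))] \in E c.
      by rewrite setUC (_ : 2 * k + 1 - t = (2 * k + 1 - t.+1).+1) ?addnS; [apply: wE|lia].
    apply: leq_trans (unused_lipschitz ikl cu Et _) _; rewrite /m; lia.
  have all_m t : t <= 2 * k + 1 -> dep (w (i0 + t)) <= m.
    move=> tN; have [tk|tk] := leqP t k; first by have := fwd t tk; rewrite /m; lia.
    have := bwd (2 * k + 1 - t); rewrite subKn // /m; lia.
  have [t tN eqt] : exists2 t, t < 2 * k + 1 & dep (w (i0 + t)) = dep (w (i0 + t.+1)).
    have [/existsP[t /eqP eqt]|/existsPn ne] :=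
      boolP [exists t : 'I_(2 * k + 1), dep (w (i0 + t)) == dep (w (i0 + t.+1))].
      by exists t.
    have parity t : t <= 2 * k + 1 -> odd (dep (w (i0 + t))) = odd (dep (w i0)) (+) odd t.
      elim: t => [|t IHt] tN; first by rewrite addn0 addbF.
      have tm := all_m t (ltnW tN); have t1m := all_m t.+1 tN.
      have stepE := wE (i0 + t); rewrite -addnS in stepE.
      have up : dep (w (i0 + t.+1)) <= (dep (w (i0 + t))).+1.
        have [tlt|tge] := ltnP (dep (w (i0 + t))) m.
          exact: unused_lipschitz ikl cu stepE tlt.
        exact: leq_trans t1m (leqW tge).
      have down : dep (w (i0 + t)) <= (dep (w (i0 + t.+1))).+1.
        have [tlt|tge] := ltnP (dep (w (i0 + t.+1))) m.
          by apply: unused_lipschitz ikl cu _ tlt; rewrite setUC.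
        exact: leq_trans tm (leqW tge).
      have := ne (Ordinal tN); have := IHt (ltnW tN).
      rewrite /= addbN => <-; move: up down.
      move: (dep _) (dep _) => p q; clear; lia.
    by have := parity _ (leqnn _); rewrite wP addn1 /= mul2n odd_double addbT; case: odd.
  have tm : dep (w (i0 + t)) < m.+1 by rewrite ltnS; apply/all_m/ltnW.
  apply/bigcupP; exists (Ordinal tm) => //; rewrite inE cu /=.
  apply/existsP; exists (w (i0 + t)); apply/existsP; exists (w (i0 + t.+1)).
  by rewrite -eqt addn0 !eqxx addnS wE.
apply: leq_trans (subset_leq_card sub) _.
apply: leq_trans (leq_card_setU _ _) _.
apply: leq_trans (leq_add (card_used _) (card_bigcup_leq _ (fun j => unused_at m j false))) _.
have le2 : \sum_(j < m.+1) #|unused_at m j false| <= \sum_(j < m.+1) 2 * l * #|level j|.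
  apply: leq_sum => j _; have jm : j <= m by rewrite -ltnS.
  have := @card_unused_at true false m j (fun=> isT) _ jm noC; rewrite mul0n !addn0.
  by apply; apply: leq_trans ikl.
rewrite -big_distrr sum_levels /= in le2.
by rewrite mulnDl mul1n addnC leq_add2r.
Qed.

(** A colour at the root is used on level 1, or its edge leads to a vertex of the ball of radius 1
    which, by disjointness, determines the colour. *)
Lemma root_expansion D : 0 < l -> D <= #|[set c | x \in cover (E c)]| ->
  D <= 2 * #|ball 1|.
Proof.
move=> l0 /leq_trans; apply.
set C := [set c | _]; have [dep0 _ _ _] := bfs.
have dx : dep x = 0 by apply/eqP; rewrite dep0.
rewrite mul2n -addnn -(cardsID (used_colors dep tc 1) C) leq_add //.
  by apply: leq_trans (card_used 1); apply/subset_leq_card/subsetIr.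
pose g c := odflt x [pick w | [set x; w] \in E c].
have gP c : c \in C -> [set x; g c] \in E c.
  rewrite inE => /bigcupP[f fE xf]; rewrite /g; case: pickP => //= noW.
  have /eqP/cards2P[u [w [uw fE']]] := E_card fE.
  move: xf; rewrite fE' !inE => /orP[]/eqP eqx; subst.
    by have := noW w; rewrite fE.
  by have := noW u; rewrite setUC fE.
rewrite -(@card_in_imset _ _ g).
  apply/subset_leq_card/subsetP => _ /imsetP[c + ->]; rewrite !inE => /andP[cu cC].
  rewrite -[1]/(0.+1) -dx; apply: (unused_lipschitz l0 cu); last by rewrite dx.
  by apply: gP; rewrite inE.
move=> c c' /setDP[cC _] /setDP[c'C _] eqg.
by apply: (E_disj (gP c cC)); rewrite eqg gP.
Qed.

End Expansion.

(** * Size bounds for families without rainbow cycles *)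

Lemma cover0 (T : finType) : cover (set0 : {set {set T}}) = set0.
Proof. by apply/setP => v; rewrite inE; apply/bigcupP => -[f]; rewrite inE. Qed.

(** The bound at radius [r] counts as a first expansion, hence the exponent [t.+1] after [t] further
    steps. *)
Lemma geometric_growth (a : nat -> nat) D C k r t :
  D <= C * a r -> (forall i, i < t -> D * a (r + i * k) <= C * a (r + i * k + k)) ->
  D ^ t.+1 <= C ^ t.+1 * a (r + t * k).
Proof.
move=> D0; elim: t => [|t IHt] step; first by rewrite addn0 !expn1.
have IH := IHt (fun i it => step i (ltnW it)); have st := step t (ltnSn t).
rewrite mulSn [k + _]addnC addnA expnS [C ^ _]expnS.
apply: leq_trans (leq_mul (leqnn D) IH) _.
by rewrite mulnCA [C * _]mulnC -mulnA leq_mul2l st orbT.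
Qed.

Section MainBounds.
Variables (V K : finType) (E : K -> {set {set V}}) (S : {set K}).
Hypothesis E_card : forall c f, f \in E c -> #|f| = 2.
Hypothesis E_disj : forall c c' f, f \in E c -> f \in E c' -> c = c'.
Hypothesis S_ne : forall c, c \in S -> cover (E c) != set0.

(** Colours outside the dense core are emptied. Every tree vertex is then covered by a surviving
    edge, the root by choice and the others by the edge to their parent, so the degree bound of the
    core applies to it. *)
Lemma dense_bfs l : S != set0 -> exists E' D x dep par tc,
  [/\ forall c, c \in S /\ E' c = E c \/ E' c = set0,
      rainbow_bfs E' x l dep par tc, #|S| <= D * #|V| &
      forall v, dep v <= l -> D <= #|[set c | v \in cover (E' c)]|].
Proof.
move=> S0; have [S' [D [sS S'0 SD deg]]] := dense_core S_ne S0.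
have [c0 c0S] := set0Pn _ S'0.
have [x xc0] := set0Pn _ (S_ne (subsetP sS _ c0S)).
pose E' c := if c \in S' then E c else set0.
have [dep [par [tc bfs]]] := rainbow_bfs_exists E' x l c0.
exists E', D, x, dep, par, tc; split=> //.
  by move=> c; rewrite /E'; case: ifP => [/(subsetP sS)|_]; [left|right].
have deg' v c : v \in cover (E' c) -> D <= #|[set c | v \in cover (E' c)]|.
  rewrite {1}/E'; case: ifP => [cS' vc|_]; last by rewrite cover0 inE.
  apply: leq_trans (deg c v cS' vc) _; apply/subset_leq_card/subsetP => d.
  by rewrite !inE /E' => /andP[->].
have [dep0 depE _ _] := bfs => v vl; have [v0|v0] := posnP (dep v).
  move/eqP: v0; rewrite dep0 => /eqP->; apply: (deg' x c0).
  by rewrite /E' c0S.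
have [|_ vE] := depE v; first by rewrite v0.
by apply: (deg' v (tc v)); apply/bigcupP; exists [set v; par v]; rewrite ?set21.
Qed.

Lemma rainbow_cycle_sub (E' : K -> {set {set V}}) m : (forall c, E' c \subset E c) ->
  rainbow_cycle E' m -> rainbow_cycle E m.
Proof.
move=> sE [s [szs cs u1 u2]]; exists s; split=> //.
by apply: sub_cycle cs => y z; apply/subsetP/sE.
Qed.

Lemma even_bound l : 0 < l -> (forall c, #|cover (E c)| <= 2) ->
  ~ rainbow_cycle E (2 * l) ->
  exists D, #|S| <= D * #|V| /\ D ^ l <= (2 * (6 * l + 1)) ^ l * #|V|.
Proof.
move=> l0 le2 noC; have [->|S0] := eqVneq S set0.
  by exists 0; rewrite cards0; split=> //; rewrite exp0n.
have [E' [D [x [dep [par [tc [E'E bfs SD deg]]]]]]] := dense_bfs l S0.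
exists D; split=> //.
have sE c : E' c \subset E c by case: (E'E c) => [[_ ->]|->]; rewrite ?sub0set.
have step i : i < l -> D * #|[set v | dep v <= i]| <=
    2 * (6 * l + 1) * #|[set v | dep v <= i.+1]|.
  move=> il; apply: (@even_expansion _ _ E' _ _ x l dep par tc bfs i D il).
  - by move=> c f /(subsetP (sE c)); apply: E_card.
  - by move=> c c' f /(subsetP (sE c)) fc /(subsetP (sE c')); apply: E_disj fc.
  - by move=> /(rainbow_cycle_sub sE).
  - by move=> v vi; apply: deg; apply: leq_trans vi (ltnW il).
  - by move=> c; case: (E'E c) => [[_ ->]|->]; rewrite ?le2 // cover0 cards0.
have dx : dep x = 0 by case: bfs => dep0 _ _ _; apply/eqP; rewrite dep0.
case: l l0 bfs step {deg noC} => // l _ bfs step.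
(* The start at radius 1 comes from [step 0], as the ball of radius 0 contains [x]. *)
have grow := @geometric_growth (fun i => #|[set v | dep v <= i]|) D (2 * (6 * l.+1 + 1)) 1 1 l.
apply: leq_trans (grow _ _) _ => [|i il|].
- apply: leq_trans (step 0 isT); rewrite -[leqLHS]muln1 leq_mul2l.
  by rewrite orbC card_gt0; apply/orP; left; apply/set0Pn; exists x; rewrite inE dx.
- by rewrite muln1 (addn1 (1 + i)) add1n; apply: (step i.+1).
- by rewrite leq_mul2l max_card orbT.
Qed.

(** [root_expansion] yields the ball of radius [r], and [t] expansions by [k] then reach radius [l],
    whose ball has at most [#|V|] vertices. *)
Lemma odd_bound k l r t : 0 < k -> 0 < r <= k -> l = r + t * k ->
  (forall c, c \in S -> odd_closed_walk k (E c)) ->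
  ~ rainbow_cycle E (2 * l + 1) ->
  exists D, #|S| <= D * #|V| /\
    D ^ t.+1 <= ((2 * k + 1) * (2 * l + 1)) ^ t.+1 * #|V|.
Proof.
move=> k0 /andP[r0 rk] lE odd_c noC; have [->|S0] := eqVneq S set0.
  by exists 0; rewrite cards0; split=> //; rewrite exp0n.
have [E' [D [x [dep [par [tc [E'E bfs SD deg]]]]]]] := dense_bfs l S0.
exists D; split=> //.
have sE c : E' c \subset E c by case: (E'E c) => [[_ ->]|->]; rewrite ?sub0set.
have E'_card c f : f \in E' c -> #|f| = 2 by move=> /(subsetP (sE c)); apply: E_card.
have E'_disj c c' f : f \in E' c -> f \in E' c' -> c = c'.
  by move=> /(subsetP (sE c)) fc /(subsetP (sE c')); apply: E_disj fc.
have l0 : 0 < l by rewrite lE addn_gt0 r0.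
have dx : dep x = 0 by case: bfs => dep0 _ _ _; apply/eqP; rewrite dep0.
have xl : dep x <= l by rewrite dx.
have grow := @geometric_growth (fun i => #|[set v | dep v <= i]|) D
    ((2 * k + 1) * (2 * l + 1)) k r t.
apply: leq_trans (grow _ _) _ => [|i it|].
- have h := root_expansion E'_card E'_disj bfs l0 (deg x xl).
  apply: leq_trans h _; apply: leq_mul; first by nia.
  by apply/subset_leq_card/subsetP => v; rewrite !inE => /leq_trans; apply.
- apply: (odd_expansion E'_card E'_disj bfs).
  + by rewrite lE -addnA leq_add2l -mulSnr leq_mul2r it orbT.
  + by move=> /(rainbow_cycle_sub sE).
  + move=> v vi; apply: deg; apply: leq_trans vi _.
    by rewrite lE leq_add2l leq_mul2r ltnW ?orbT.
  + move=> c; case: (E'E c) => [[cS ->] _|->]; first exact: odd_c.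
    by rewrite cover0 eqxx.
- by rewrite leq_mul2l max_card orbT.
Qed.

End MainBounds.

(** * From families of copies to coloured edge sets *)

Lemma rainbow_copy_cycle (n m : nat) (S : {set subgraph n})
    (E : subgraph n -> {set {set 'I_n}}) :
  0 < m -> (forall c f, f \in E c -> c \in S /\ f \in c.2) ->
  rainbow_cycle E m -> rainbow_copy S (cycle_graph m).
Proof.
case: m => // m _ ES [[|y s] [// szs cyc u1 u2]].
case: szs cyc u1 u2 => <- cyc u1 u2.
pose f := [ffun i : 'I_(size s).+1 => (nth y (y :: s) i).2].
pose pos (e : {set 'I_(size s).+1}) := odflt ord0 [pick i | e == [set i; ordS i]].
(* The colour of the edge from [i] to [ordS i] is stored at its second end. *)
pose col := [ffun e : {set 'I_(size s).+1} => (nth y (y :: s) (ordS (pos e))).1].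
have posP (e : {set 'I_(size s).+1}) : e \in cycle_edges (size s).+1 -> e = [set pos e; ordS (pos e)].
  rewrite inE => /andP[_ /existsP[i ei]]; rewrite /pos; case: pickP => [j /eqP //|/(_ i)].
  by rewrite ei.
have edge i : [set f i; f (ordS i)] \in E (nth y (y :: s) (ordS i)).1.
  have /(_ i) := pathP y cyc; rewrite size_rcons => /(_ (ltn_ord i)).
  rewrite -rcons_cons nth_rcons ltn_ord /rainbow_step /= !ffunE.
  suff -> : nth y (rcons s y) i = nth y (y :: s) (i.+1 %% (size s).+1) by [].
  rewrite nth_rcons; case: (ltngtP i (size s)) => [lti|gti|eqi].
  - by rewrite modn_small.
  - by have := ltn_ord i; rewrite ltnS leqNgt gti.
  - by rewrite eqi modnn.
have injf : injective f.
  move=> i j; rewrite !ffunE -!(nth_map y y.2 snd) ?ltn_ord // => eqf.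
  by apply/val_inj/eqP; rewrite -(nth_uniq y.2 _ _ u2) ?size_map ?ltn_ord // eqf.
apply/existsP; exists f; apply/existsP; exists col; apply/and3P; split.
- exact/injectiveP.
- apply/dinjectiveP => e e' /posP eE /posP e'E; rewrite !ffunE => eqc.
  suff eqp : ordS (pos e) = ordS (pos e').
    by rewrite eE e'E (can_inj (@ordSK _) eqp).
  apply/val_inj/eqP; rewrite -(nth_uniq y.1 _ _ u1) ?size_map ?ltn_ord //.
  by rewrite !(nth_map y) ?ltn_ord // eqc.
- apply/forall_inP => e /posP eE; have /ES[colS] := edge (pos e).
  rewrite [col e]ffunE colS.
  suff -> : f @: e = [set f (pos e); f (ordS (pos e))] by [].
  by rewrite -(imset_set1 f (pos e)) -(imset_set1 f (ordS _)) -imsetU -eE.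
Qed.

Section Copies.
Variables (n : nat) (F : sgraph).

Lemma copy_edges_card (C : subgraph n) e : is_copy F C -> e \in C.2 -> #|e| = 2.
Proof.
move=> /existsP[f /and3P[/injectiveP injf _ /eqP ->]] /imsetP[e' e'F ->].
by rewrite card_imset //; apply/eqP; apply: (forall_inP (edgesP F)).
Qed.

Lemma copy_edges_neq0 (C : subgraph n) : edges F != set0 -> is_copy F C -> C.2 != set0.
Proof.
move=> /set0Pn[e eF] /existsP[f /and3P[_ _ /eqP ->]].
by apply/set0Pn; exists (f @: e); apply: imset_f.
Qed.

Definition an_edge (C : subgraph n) : {set 'I_n} := odflt set0 [pick e in C.2].

Lemma an_edge_in (C : subgraph n) : edges F != set0 -> is_copy F C -> an_edge C \in C.2.
Proof.
move=> F0 /(copy_edges_neq0 F0)/set0Pn[e eC]; rewrite /an_edge; case: pickP => //= /(_ e).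
by rewrite eC.
Qed.

Variable (S : {set subgraph n}).
Hypothesis ed_S : edge_disjoint_copies F S.

Lemma copy_of C : C \in S -> is_copy F C.
Proof. by have /andP[/forall_inP + _] := ed_S; apply. Qed.

Lemma common_edge C D e : C \in S -> D \in S -> e \in C.2 -> e \in D.2 -> C = D.
Proof.
move=> CS DS eC eD; have /andP[_ /forall_inP/(_ C CS)/forall_inP/(_ D DS)] := ed_S.
by case: eqP => //= _ /disjoint_setI0/setP/(_ e); rewrite !inE eC eD.
Qed.

Lemma rainbow_free_leq_turan G :
  edges F != set0 -> ~~ rainbow_copy S G -> #|S| <= turan n G.
Proof.
move=> F0 noR; have pickS C : C \in S -> an_edge C \in C.2.
  by move=> /copy_of; apply: an_edge_in.
have inj : {in S &, injective an_edge}.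
  move=> C D CS DS eqe; apply: (common_edge CS DS (pickS C CS)).
  by rewrite eqe pickS.
rewrite -(card_in_imset inj) /turan; set H := _ @: _.
apply: (@leq_bigmax_cond _ _ (fun H' : {set {set 'I_n}} => #|H'|) H); apply/andP; split.
  apply/forall_inP => _ /imsetP[C CS ->]; apply/eqP.
  by apply: copy_edges_card (copy_of CS) (pickS C CS).
apply: contra noR => /existsP[f /andP[injf /forall_inP fH]].
(* The colour of an edge is the copy whose selected edge is its image; the default is never reached
   on edges of [G]. *)
pose col := [ffun e : {set G} => odflt (set0, set0) [pick C in S | an_edge C == f @: e]].
have colP e : e \in edges G -> col e \in S /\ an_edge (col e) = f @: e.
  move=> /fH /imsetP[C CS fe]; rewrite ffunE; case: pickP => [D /andP[DS /eqP eD] //|/(_ C)].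
  by rewrite CS fe eqxx.
apply/existsP; exists f; apply/existsP; exists col; apply/and3P; split=> //.
  apply/dinjectiveP => e e' /colP[_ ce] /colP[_ ce'] eqc.
  by apply: (imset_inj (injectiveP _ injf)); rewrite -ce -ce' eqc.
apply/forall_inP => e /colP[cS <-]; rewrite cS /=; exact: pickS.
Qed.

(** Keeping one edge of each copy of [F] reduces to colour classes with a single edge, which cover
    two vertices. *)
Lemma rainbow_free_even_bound l : 0 < l -> edges F != set0 ->
  ~~ rainbow_copy S (cycle_graph (2 * l)) ->
  exists D, #|S| <= D * n /\ D ^ l <= (2 * (6 * l + 1)) ^ l * n.
Proof.
move=> l0 F0 noR; have pickS C : C \in S -> an_edge C \in C.2.
  by move=> /copy_of; apply: an_edge_in.
pose E C := if C \in S then [set an_edge C] else set0.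
have EP C e : e \in E C -> C \in S /\ e = an_edge C.
  by rewrite /E; case: ifP => [_ /set1P|]; rewrite ?inE.
have card2 C : C \in S -> #|an_edge C| = 2.
  by move=> CS; apply: copy_edges_card (copy_of CS) (pickS C CS).
have := @even_bound _ _ E S _ _ _ l l0; rewrite card_ord; apply.
- by move=> C e /EP[/card2 + ->].
- by move=> C D e /EP[CS ->] /EP[DS eqe]; apply: (common_edge CS DS (pickS C CS)); rewrite eqe pickS.
- move=> C CS; rewrite /E CS; apply/set0Pn; rewrite /cover big_set1.
  by apply/set0Pn; rewrite -card_gt0 card2.
- move=> C; rewrite /E; case: ifP => [CS|_]; last by rewrite cover0 cards0.
  by rewrite /cover big_set1 card2.
- move=> /rainbow_copy_cycle RC; case/negP: noR; apply: RC; first by rewrite muln_gt0.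
  by move=> C e /EP[CS ->]; rewrite CS pickS.
Qed.

End Copies.

Lemma odd_cycle_copy_walk n k (C : subgraph n) : 0 < k ->
  is_copy (cycle_graph (2 * k + 1)) C -> odd_closed_walk k C.2.
Proof.
move=> k0 /existsP[f /and3P[/injectiveP injf _ /eqP CE]].
have N0 : 0 < 2 * k + 1 by rewrite addn1.
pose w i := f (Ordinal (ltn_pmod i N0)).
exists w; split.
- move=> i; pose j := Ordinal (ltn_pmod i N0).
  have -> : [set w i; w i.+1] = f @: [set j; ordS j].
    rewrite imsetU !imset_set1; congr [set _; f _]; apply: val_inj => /=.
    by rewrite -(addn1 (i %% _)) modnDml (addn1 i).
  rewrite CE; apply: imset_f; rewrite inE; apply/andP; split; last first.
    by apply/existsP; exists j.
  (* As [0 < k], the cycle has length above 1, so [j] differs from its cyclic successor. *)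
  rewrite cards2 (_ : j != _) //; apply/eqP => /(congr1 val) /=.
  have := ltn_pmod i N0; move: (i %% _) => r rN.
  have [rl|] := ltnP r.+1 (2 * k + 1); first by rewrite modn_small //; lia.
  by move=> h; rewrite (_ : r.+1 = 2 * k + 1) ?modnn; lia.
- by move=> i; congr (f _); apply: val_inj; rewrite /= modnDr.
- move=> v /bigcupP[e]; rewrite CE => /imsetP[e' _ ->] /imsetP[j _ ->].
  exists j => //; congr (f _); apply: val_inj; rewrite /= modn_small //.
Qed.

Lemma rainbow_free_odd_bound n k l r t (S : {set subgraph n}) :
  0 < k -> 0 < r <= k -> l = r + t * k ->
  edge_disjoint_copies (cycle_graph (2 * k + 1)) S ->
  ~~ rainbow_copy S (cycle_graph (2 * l + 1)) ->
  exists D, #|S| <= D * n /\ D ^ t.+1 <= ((2 * k + 1) * (2 * l + 1)) ^ t.+1 * n.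
Proof.
move=> k0 rk lE edS noR.
pose E (C : subgraph n) := if C \in S then C.2 else set0.
have EP C e : e \in E C -> C \in S /\ e \in C.2.
  by rewrite /E; case: ifP => // _; rewrite inE.
have walk C : C \in S -> odd_closed_walk k (E C).
  by move=> CS; rewrite /E CS; apply: odd_cycle_copy_walk k0 (copy_of edS CS).
have := @odd_bound _ _ E S _ _ _ k l r t k0 rk lE walk; rewrite card_ord; apply.
- by move=> C e /EP[CS]; apply: copy_edges_card (copy_of edS CS).
- by move=> C D e /EP[CS eC] /EP[DS]; apply: common_edge edS _ _ _ CS DS eC.
- move=> C /walk[w [wE _ _]]; apply/set0Pn; exists (w 0).
  by apply/bigcupP; exists [set w 0; w 1]; rewrite ?set21.
- move=> /rainbow_copy_cycle RC; case/negP: noR; apply: RC EP; by rewrite addn1.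
Qed.

(** The first alternative accounts for a maximum over an empty range. *)
Lemma multicolor_turan_attained n F G : multicolor_turan n F G = 0 \/
  exists S : {set subgraph n}, [/\ edge_disjoint_copies F S,
    ~~ rainbow_copy S G & multicolor_turan n F G = #|S|].
Proof.
rewrite /multicolor_turan.
set P := [pred S : {set subgraph n} | edge_disjoint_copies F S && ~~ rainbow_copy S G].
have [P0|P0] := posnP #|P|.
  by left; apply: big_pred0 => S; have := card0_eq P0 S; rewrite !inE.
have [S /andP[edS noR] eqS] := eq_bigmax_cond (fun S : {set subgraph n} => #|S|) P0.
by right; exists S.
Qed.

(* Real exponents and the asymptotic statements *)
From mathcomp Require Import all_boot all_order all_algebra.
From mathcomp Require Import all_classical all_reals all_analysis.
Import Order.TTheory GRing.Theory Num.Theory.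
Import numFieldNormedType.Exports.
Local Open Scope classical_set_scope.
Local Open Scope ring_scope.

(** Taking [s]-th roots gives [D <= C * n ^ (1 / s)], which is then multiplied by [n]; splitting the
    exponent needs [n] nonzero. *)
Lemma powR_bound (R : realType) (N D C n s : nat) :
  (0 < s)%N -> (N <= D * n)%N -> (D ^ s <= C ^ s * n)%N ->
  N%:R <= C%:R * (n%:R : R) `^ (1 + 1 / s%:R).
Proof.
move=> s0 ND DC; have [n0|n0] := posnP n.
  by move: ND; rewrite n0 muln0 leqn0 => /eqP->; rewrite mulr_ge0 // powR_ge0.
rewrite powRD; last by rewrite pnatr_eq0 -lt0n n0 implybT.
rewrite powRr1 // mulrCA mulrC.
apply: (@le_trans _ _ (D%:R * n%:R)); first by rewrite -natrM ler_nat.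
rewrite ler_wpM2r // -(@ler_pXn2r _ s) ?nnegrE ?mulr_ge0 ?powR_ge0 //.
rewrite exprMn -[X in _ * X]powR_mulrn ?powR_ge0 // -powRrM divfK ?pnatr_eq0 -?lt0n //.
by rewrite powRr1 // -!natrX -natrM ler_nat.
Qed.

Lemma ceil_div (R : realType) (k l : nat) : (0 < k)%N -> (0 < l)%N ->
  exists r t, [/\ (0 < r <= k)%N, l = (r + t * k)%N &
    Num.ceil ((l%:R : R) / k%:R) = t.+1%:Z].
Proof.
(* Dividing [l.-1] instead of [l] puts the remainder [r] between 1 and [k], so that the ceiling is
   always [t.+1]. *)
move=> k0 l0; exists (l.-1 %% k)%N.+1, (l.-1 %/ k)%N.
have lE : (l = (l.-1 %% k).+1 + l.-1 %/ k * k)%N.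
  by have := divn_eq l.-1 k; lia.
have rk : (l.-1 %% k < k)%N by rewrite ltn_mod.
split=> //; apply: ceil_def.
have k0' : 0 < k%:R :> R by rewrite ltr0n.
rewrite -natz -[X in (_ - X)]natz -natrB // subn1 /= !natz !pmulrn.
rewrite ltr_pdivlMr // ler_pdivrMr // -!natrM ltr_nat ler_nat.
apply/andP; split; lia.
Qed.

Theorem theorem1p1 (R : realType) :
  (forall F : sgraph, edges F != finset.set0 ->
     (forall G : sgraph, bipartite G ->
        (fun n : nat => (multicolor_turan n F G)%:R : R^o)
          =O_\oo (fun n : nat => (turan n G)%:R : R^o)) /\
     (forall l : nat, (2 <= l)%N ->
        (fun n : nat => (multicolor_turan n F (cycle_graph (2 * l)))%:R : R^o)
          =O_\oo (fun n : nat => (n%:R : R) `^ (1 + 1 / l%:R) : R^o))) /\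
  (forall k l : nat, (1 <= k)%N -> (1 <= l)%N -> (k < l)%N ->
     forall n : nat,
       (multicolor_turan n (cycle_graph (2 * k + 1)) (cycle_graph (2 * l + 1)))%:R
         <= 8%:R * (k + 1)%:R ^+ 2 * l%:R *
            (n%:R : R) `^ (1 + 1 / (Num.ceil ((l%:R : R) / k%:R))%:~R)).
Proof.
split=> [F F0|k l k0 l0 kl n]; first split=> [G _|l l2].
(* The constant is 1, since the multicolour number is at most the classical one for every [n]. *)
- apply/eqO_exP; exists 1 => //; apply: filterE => n.
  rewrite mul1r !ger0_norm // ler_nat.
  have [->//|[S [edS noR ->]]] := multicolor_turan_attained n F G.
  exact: (rainbow_free_leq_turan edS F0 noR).
- have l0 : (0 < l)%N by apply: ltnW.
  apply/eqO_exP; exists (2 * (6 * l + 1))%:R; first by rewrite ltr0n; lia.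
  apply: filterE => n; rewrite !ger0_norm ?powR_ge0 //.
  have [->|[S [edS noR ->]]] := multicolor_turan_attained n F (cycle_graph (2 * l)).
    by rewrite mulr_ge0 // powR_ge0.
  have [D [SD DC]] := rainbow_free_even_bound edS l0 F0 noR.
  exact: powR_bound l0 SD DC.
have [r [t [rk lE ->]]] := ceil_div R k0 l0.
rewrite -pmulrn.
have [->|[S [edS noR ->]]] := multicolor_turan_attained n (cycle_graph (2 * k + 1))
  (cycle_graph (2 * l + 1)).
  by rewrite !mulr_ge0 ?exprn_ge0 ?powR_ge0.
have [D [SD DC]] := rainbow_free_odd_bound k0 rk lE edS noR.
apply: le_trans (powR_bound R _ SD DC) _ => //.
(* What remains is [(2 * k + 1) * (2 * l + 1) <= 8 * (k + 1) ^ 2 * l]. *)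
rewrite ler_wpM2r ?powR_ge0 // -natrX -!natrM ler_nat.
nia.
Qed.
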